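(* Let $0\le q<r\le m$ and $k\in\mathbb{Z}_{\ge0}$, consider $QRM_m(q,r)$, and let $K\in\mathcal{Q}_k$. Then: 1. If $q\ge1$ then $Z(k)_{\langle K\rangle}\equiv\widetilde{Z}(k)_{\langle K\rangle}$. 2. If $|K|\ge q+kr+2$ then $Z(k)_{\langle K\rangle}\equiv\widetilde{Z}(k)_{\langle K\rangle}$.
   Context: $S=\{e_1,\dots,e_m\}$ is the standard basis of $\mathbb{Z}_2^m$. For $J\subseteq S$, $\langle J\rangle$ is the subgroup generated by $J$. A subcube of type $J$ is a coset $x+\langle J\rangle$, of dimension $|J|$. $|x|$ is Hamming weight. $2^m$ physical qubits are indexed by $\mathbb{Z}_2^m$; $U_A$ acts as the single-qubit gate $U$ on qubits in $A$ and identity elsewhere. $QRM_m(q,r)$ is the common $+1$ eigenspace of all $X_A$ with $A$ an $(m-q)$-dimensional subcube and all $Z_A$ with $A$ an $(r+1)$-dimensional subcube. $Z(k)=\mathrm{diag}(1,e^{i\pi/2^k})$; $Z(k)_A$ acts as $Z(k)$ on qubits in $A$ and identity elsewhere; $\widetilde{Z}(k)_A$ acts on qubit $x$ as $Z(k)$ if $x\in A$, $|x|$ even; as $Z(k)^\dagger$ if $x\in A$, $|x|$ odd; identity if $x\notin A$. $\mathcal{Q}_k=\{K\subseteq S: q+kr+1\le|K|\le(k+1)r\}$. $U\equiv V$ (logical equivalence) means that for some real $\theta$, $U|\psi\rangle=e^{i\theta}V|\psi\rangle$ for every code state $|\psi\rangle$. *)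

(* Defs.v *)
From HB Require Import structures.
From mathcomp Require Import all_boot all_order all_algebra all_fingroup.
From mathcomp Require Import reals trigo complex.

Set Implicit Arguments.
Unset Strict Implicit.
Unset Printing Implicit Defensive.

Import Order.TTheory GRing.Theory Num.Theory.
Local Open Scope ring_scope.
Local Open Scope sesquilinear_scope.
Local Open Scope complex_scope.

Notation cube m := 'rV['F_2]_m.

Definition std_basis (m : nat) : {set cube m} :=
  [set delta_mx 0 i | i : 'I_m].

(* The finite group underlying [cube m] is its additive group, so that
   [<<J>>] is the additive subgroup generated by [J]. *)
Definition gen_subcube (m : nat) (J : {set cube m}) : {set cube m} :=
  <<J>>%g.

Definition is_subcube (m d : nat) (A : {set cube m}) : Prop :=
  exists (x : cube m) (J : {set cube m}),
    [/\ J \subset std_basis m, #|J| = d & A = [set x + y | y in gen_subcube J]].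

Definition hweight (m : nat) (x : cube m) : nat :=
  #|[set i : 'I_m | x 0 i != 0]|.

(* One label in {0,1} for each of the 2 ^ m qubits; a state is the family of
   its amplitudes in the computational basis. *)
Notation labels m := {ffun cube m -> 'I_2}.
Notation state R m := {ffun labels m -> R[i]}.

Section Gates.
Variable R : realType.

Definition expi (t : R) : R[i] := cos t +i* sin t.

Definition pauliX : 'M[R[i]]_2 := \matrix_(a, b) (a != b)%:R.

Definition pauliZ : 'M[R[i]]_2 := diag_mx (\row_a (if a == 0 then 1 else -1)).

Definition Zrot (k : nat) : 'M[R[i]]_2 :=
  diag_mx (\row_a (if a == 0 then 1 else expi (pi / 2 ^+ k))).

Section Operators.
Variable m : nat.

(* The tensor product over x of the single-qubit operators [U x]: its matrix
   entry between basis states b and c is the product of the entries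
   [U x (b x) (c x)]. *)
Definition tensor_op (U : cube m -> 'M[R[i]]_2) (psi : state R m) :
  state R m :=
  [ffun b : labels m =>
     \sum_(c : labels m) (\prod_(x : cube m) U x (b x) (c x)) * psi c].

Definition gate_on (U : 'M[R[i]]_2) (A : {set cube m}) :
  state R m -> state R m :=
  tensor_op (fun x => if x \in A then U else 1%:M).

Definition Zrot_on (k : nat) (A : {set cube m}) : state R m -> state R m :=
  gate_on (Zrot k) A.

Definition signed_Zrot_on (k : nat) (A : {set cube m}) :
  state R m -> state R m :=
  tensor_op (fun x => if x \in A then
                        if odd (hweight x) then (Zrot k)^t* else Zrot k
                      else 1%:M).

Definition QRM (q r : nat) (psi : state R m) : Prop :=
  (forall A, is_subcube (m - q) A -> gate_on pauliX A psi = psi) /\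
  (forall A, is_subcube r.+1 A -> gate_on pauliZ A psi = psi).

Definition logically_equiv (code : state R m -> Prop)
    (U V : state R m -> state R m) : Prop :=
  exists theta : R, forall psi : state R m,
    code psi -> U psi = [ffun b => expi theta * V psi b].

End Operators.
End Gates.

Definition Qset (m q r k : nat) : {set {set cube m}} :=
  [set K : {set cube m} | (K \subset std_basis m) &&
     (q + k * r + 1 <= #|K| <= (k + 1) * r)%N].

(* Main.v *)
Require Import Defs.
From HB Require Import structures.
From mathcomp Require Import all_boot all_order all_algebra all_fingroup.
From mathcomp Require Import reals trigo complex.
From mathcomp Require Import zify.

Set Implicit Arguments.
Unset Strict Implicit.
Unset Printing Implicit Defensive.
Import Order.TTheory GRing.Theory Num.Theory.

(* At a label b occurring in a code state the two gates differ by the phase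
   exp(2 pi i / 2^k)^N, where N counts the odd points of <K> at which b is 1.
   As b has degree at most r over F_2, McEliece's divisibility theorem, applied
   to b on the affine hyperplane of odd points of <K>, whose dimension
   |K| - 1 exceeds k r, gives 2^k | N; hence the gates agree on the code, with
   theta = 0. *)

(** * Counting in intervals of the Boolean lattice *)

Section BooleanFunctions.
Variable I : finType.
Implicit Types (U K J B T x y : {set I}) (f : {set I} -> bool).

Lemma card_set_itv U K : U \subset K ->
  #|[set x : {set I} | (U \subset x) && (x \subset K)]| = 2 ^ #|K :\: U|.
Proof.
move=> sUK; rewrite -card_powerset.
rewrite -(card_in_imset (f := fun y => U :|: y) (D := powerset (K :\: U))).
  apply: eq_card => x; rewrite inE; apply/andP/imsetP.
    move=> [sUx sxK]; exists (x :\: U); first by rewrite inE setSD.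
    by rewrite -{1}(setID x U) (setIidPr sUx).
  move=> [y]; rewrite inE subsetD => /andP[syK dyU] ->.
  by rewrite subsetUl subUset sUK.
move=> y1 y2; rewrite !inE !subsetD => /andP[_ d1] /andP[_ d2] eqU.
have E y : [disjoint y & U] -> (U :|: y) :\: U = y.
  by move=> d; rewrite setDUl setDv set0U; apply/setDidPl.
by rewrite -(E _ d1) -(E _ d2) eqU.
Qed.

(** For a fixed i in K outside U, deleting i maps the odd sets of the interval bijectively onto the
    interval from U to [K :\ i]: parity decides whether i was present. *)
Lemma card_odd_set_itv U K : U \proper K ->
  #|[set x : {set I} | [&& U \subset x, x \subset K & odd #|x|]]|
    = 2 ^ (#|K| - #|U|).-1.
Proof.
case/properP=> sUK [i iK iU].
have sUKi : U \subset K :\ i by rewrite subsetD1 sUK.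
have -> : 2 ^ (#|K| - #|U|).-1 = 2 ^ #|(K :\ i) :\: U|.
  rewrite cardsD (setIidPr sUKi) (cardsD1 i K) iK.
  by congr (_ ^ _); lia.
rewrite -card_set_itv //.
pose g x := x :\ i.
rewrite -[LHS](card_in_imset (f := g)); last first.
  move=> x y; rewrite !inE => /and3P[_ _ ox] /and3P[_ _ oy] exy.
  have eixy : (i \in x) = (i \in y).
    move: ox oy; rewrite (cardsD1 i x) (cardsD1 i y) -/(g x) exy !oddD.
    by case: (i \in x); case: (i \in y) => //=; case: (odd _).
  apply/setP => j; case: (eqVneq j i) => [-> // | ji].
  by move/setP/(_ j): exy; rewrite !inE ji.
apply: eq_card => y; rewrite inE; apply/imsetP/andP.
  move=> [x]; rewrite inE => /and3P[sUx sxK _] ->.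
  by rewrite /g subsetD1 sUx iU setSD.
move=> [sUy]; rewrite subsetD1 => /andP[syK iy].
have [oy|oy] := boolP (odd #|y|).
  exists y; first by rewrite inE sUy syK.
  by apply/esym/setDidPl; rewrite disjoint_sym disjoints1.
exists (i |: y); last by rewrite /g setU1K.
rewrite inE cardsU1 iy /= oy subUset sub1set iK syK !andbT.
exact: subset_trans sUy (subsetUr _ _).
Qed.

(** * Algebraic normal form and degree over F_2 *)

Lemma odd_sum (J : finType) (P : pred J) (F : J -> nat) :
  odd (\sum_(j | P j) F j) = \big[addb/false]_(j | P j) odd (F j).
Proof. by apply: (big_morph odd oddD). Qed.

(* The monomials of the algebraic normal form of f over F_2. *)
Definition anf f : {set {set I}} :=
  [set T : {set I} | odd (\sum_(y : {set I} | y \subset T) f y)].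

(** Moebius inversion mod 2: after exchanging the sums, f y is counted once for each T between y and
    x, that is 2 ^ #|x :\: y| times, which is even unless y = x. *)
Lemma anfE f x :
  odd (\sum_(T : {set I} | T \in anf f) (T \subset x)) = f x.
Proof.
have -> : odd (\sum_(T : {set I} | T \in anf f) (T \subset x)) =
   odd (\sum_(T : {set I} | T \subset x) \sum_(y : {set I} | y \subset T) f y).
  rewrite !odd_sum [LHS]big_mkcond [RHS]big_mkcond; apply: eq_bigr => T _.
  by rewrite inE; case: (T \subset x); case: odd.
rewrite (exchange_big_dep (fun y => y \subset x)) /=; last first.
  by move=> T y /[swap]; apply: subset_trans.
rewrite odd_sum (bigD1 x) //= [X in _ (+) X]big1 ?addbF.
  by rewrite (big_pred1 x) ?oddb // => T; rewrite -eqEsubset.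
move=> y /andP[syx nyx].
rewrite (eq_bigl (mem [set T : {set I} | (y \subset T) && (T \subset x)]));
  last by move=> T; rewrite !inE andbC.
rewrite sum_nat_const card_set_itv // oddM oddX orbF.
rewrite cards_eq0 setD_eq0.
by rewrite eqEsubset syx /= in nyx; rewrite (negbTE nyx).
Qed.

(** With points encoded as sets, the sets B :|: T with T \subset J form the subcube through B in the
    directions J; disjointness normalises the base point. *)
Definition even_on_subcubes d f := forall B J, #|J| = d -> [disjoint B & J] ->
  ~~ odd (\sum_(T : {set I} | T \subset J) f (B :|: T)).

(** If T had more than r elements, its subsets would split into parallel subcubes of dimension r +
    1, each with even sum, so the coefficient of T would vanish. *)
Lemma anf_degree r f T :
  even_on_subcubes r.+1 f -> T \in anf f -> #|T| <= r.
Proof.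
move=> evf; rewrite inE; case: leqP => // ltrT; apply: contraTT => _.
have [J sJT cJ] : exists2 J : {set I}, J \subset T & #|J| = r.+1.
  move/card_geqP: ltrT => [s [us <- sT]]; exists [set z in s].
    by apply/subsetP => z; rewrite inE; apply: sT.
  by rewrite cardsE; apply/card_uniqP.
rewrite (partition_big (fun y => y :\: J) (fun B => B \subset T :\: J)) /=;
  last by move=> y; apply: setSD.
rewrite odd_sum big1 // => B sB; apply/negbTE.
have /andP[sBT dBJ] : (B \subset T) && [disjoint B & J] by rewrite -subsetD.
(* The subsets of T that agree with B outside J are exactly the sets B :|: y with y \subset J. *)
rewrite (reindex_onto (fun y => B :|: y) (fun z => z :&: J)) /=.
  rewrite (eq_bigl (fun y => y \subset J)); first exact: evf.
  move=> y; rewrite subUset sBT /= setDUl setIUl.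
  rewrite (setDidPl dBJ) (disjoint_setI0 dBJ) set0U.
  apply/idP/idP => [/andP[_ /eqP<-]|sy]; first exact: subsetIr.
  rewrite (subset_trans sy sJT) (setIidPl sy) eqxx andbT /=.
  by move: sy; rewrite -setD_eq0 => /eqP->; rewrite setU0.
by move=> y /andP[_ /eqP<-]; rewrite setUC setID.
Qed.

(** * Divisibility of signed sums over odd sets *)

Local Open Scope ring_scope.

(* The product over L is (-1)^g for the polynomial g with monomials L.
   Splitting off a monomial T replaces the constraint U \subset x by
   U :|: T \subset x at the price of a factor 2, since
   (-1)^[T \subset x] = 1 - 2 [T \subset x]; s counts the factors gained. *)
Lemma dvdz_signed_sum r k K (L : seq {set I}) U s :
    (0 < r)%N -> (k * r + 2 <= #|K|)%N ->
    {in L, forall T, #|T| <= r}%N -> (#|U| <= r * s)%N ->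
  (2 ^+ k.+1 %| 2 ^+ s *
     \sum_(x : {set I} | [&& U \subset x, x \subset K & odd #|x|])
        \prod_(T <- L) (-1 : int) ^+ (T \subset x))%Z.
Proof.
move=> r0 leK; elim: L U s => [|T L IH] U s leL leU.
  under eq_bigr do rewrite big_nil.
  rewrite sumr_const -cardsE.
  have [ks|sk] := ltnP k s.
    by rewrite dvdz_mulr // -(subnK ks) exprD dvdz_mull.
  (* As s <= k and r > 0, r s + k + 1 - s is at most k r + 1. The factor 2 ^ s and the 2 ^ (|K| -
     |U| - 1) odd sets then supply k + 1 powers of 2 together. *)
  have ltUK : (#|U| + k.+1 - s < #|K|)%N by nia.
  have [sUK|nsUK] := boolP (U \subset K); last first.
    rewrite eq_card0 ?mulr0n ?mulr0 ?dvdz0 // => x; rewrite inE.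
    by apply: contraNF nsUK => /and3P[sUx sxK _]; apply: subset_trans sxK.
  rewrite card_odd_set_itv; last by rewrite properEcard sUK; lia.
  rewrite natrX -exprD.
  have le : (k.+1 <= s + (#|K| - #|U|).-1)%N by lia.
  by rewrite -(subnK le) exprD dvdz_mull.
have leT : (#|T| <= r)%N by apply: leL; rewrite inE eqxx.
have {}leL : {in L, forall T, #|T| <= r}%N.
  by move=> T' T'L; apply: leL; rewrite inE T'L orbT.
have := IH (U :|: T) s.+1 leL.
have := IH U s leL leU.
set A := \sum_(x | _) _; set B := \sum_(x | _) _ => dA dB.
suff -> : \sum_(x : {set I} | [&& U \subset x, x \subset K & odd #|x|])
     \prod_(T <- T :: L) (-1) ^+ (T \subset x) = A - 2 * B :> int.
  rewrite mulrBr mulrA -exprSr rpredB // dB //.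
  rewrite (leq_trans (leq_card_setU _ _)) // mulnS addnC.
  by rewrite leq_add.
rewrite /A /B [X in 2 * X]big_mkcond mulr_sumr [in LHS]big_mkcond.
rewrite [X in X - _]big_mkcond -sumrB; apply: eq_bigr => x _.
rewrite big_cons subUset.
case: (U \subset x); case: (x \subset K); case: (odd _); case: (T \subset x);
  rewrite /= ?mulr0 ?subr0 ?mul1r //.
by rewrite expr1 mulN1r mulr2n mulrDl mul1r opprD addrA subrr add0r.
Qed.

(** Since 1 - (-1)^f = 2 f, twice the count is the difference of the signed sums for the empty list
    of monomials and for the list [anf f]. Both are divisible by 2 ^ (k + 1), and one factor 2
    cancels. *)
Lemma dvdn_odd_support r k K f :
    (0 < r)%N -> (k * r + 2 <= #|K|)%N -> even_on_subcubes r.+1 f ->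
  (2 ^ k %| \sum_(x : {set I} | (x \subset K) && odd #|x|) f x)%N.
Proof.
move=> r0 leK evf; set N := (\sum_(x | _) _)%N.
have d1 : (2 ^+ k.+1 %| \sum_(x : {set I} | (x \subset K) && odd #|x|)
        (-1 : int) ^+ f x)%Z.
  have := @dvdz_signed_sum r k K (enum (anf f)) set0 0 r0 leK.
  rewrite cards0 muln0 expr0 mul1r => /(_ _ isT).
  under eq_bigl do rewrite sub0set.
  under eq_bigr => x _ do rewrite big_enum /= prodrXr -signr_odd anfE.
  by apply=> T; rewrite mem_enum; apply: anf_degree.
have d2 : (2 ^+ k.+1 %| \sum_(x : {set I} | (x \subset K) && odd #|x|)
        (1 : int))%Z.
  have := @dvdz_signed_sum r k K [::] set0 0 r0 leK.
  rewrite cards0 muln0 expr0 mul1r => /(_ _ isT).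
  under eq_bigl do rewrite sub0set.
  under eq_bigr => x _ do rewrite big_nil.
  by apply.
have := rpredB d2 d1; rewrite -sumrB.
have -> : \sum_(x : {set I} | (x \subset K) && odd #|x|) (1 - (-1) ^+ f x)
   = 2 * N%:R :> int.
  rewrite /N natr_sum mulr_sumr; apply: eq_bigr => x _.
  by case: (f x); rewrite ?mulr0 ?subrr.
rewrite exprS dvdz_mul2l //.
by rewrite -natrX natz natz dvdzE.
Qed.

End BooleanFunctions.

(** * Points of the cube as subsets of ['I_m], with Hamming weight as cardinality *)

Section Subcubes.
Variable m : nat.
Implicit Types (B J T : {set 'I_m}) (x : cube m).
Local Open Scope ring_scope.

Definition supp x : {set 'I_m} := [set i | x 0 i != 0].
Definition indic T : cube m := \row_i (i \in T)%:R.

Lemma indicK : cancel indic supp.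
Proof. by move=> T; apply/setP => i; rewrite inE mxE; case: (i \in T). Qed.

Lemma suppK : cancel supp indic.
Proof.
move=> x; apply/rowP => i; rewrite mxE inE; apply: val_inj.
by case: (x 0 i) => -[|[|]].
Qed.

Lemma indicU B T : [disjoint B & T] -> indic B + indic T = indic (B :|: T).
Proof.
move=> dBT; apply/rowP => i; rewrite !mxE inE.
have [iB|] := boolP (i \in B); last by rewrite add0r.
by rewrite (disjointFr dBT iB) addr0.
Qed.

Lemma delta_row_inj : injective (fun i : 'I_m => delta_mx 0 i : cube m).
Proof. by move=> i j /rowP/(_ i); rewrite !mxE !eqxx /=; case: eqVneq. Qed.

Lemma std_basis_sub (K : {set cube m}) : K \subset std_basis m ->
  exists2 J : {set 'I_m}, K = [set delta_mx 0 i | i in J] & #|J| = #|K|.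
Proof.
move=> sK; pose J : {set 'I_m} := [set i | delta_mx 0 i \in K].
suff eK : K = [set delta_mx 0 i | i in J].
  by exists J; rewrite // [in RHS]eK (card_imset _ delta_row_inj).
apply/setP => x; apply/idP/imsetP => [xK|[i iJ ->]].
  have /imsetP[i _ xi] := subsetP sK _ xK.
  by exists i; rewrite // inE -xi.
by rewrite inE in iJ.
Qed.

(** The vectors supported in J form a subgroup containing the generators; conversely, each such
    vector is the sum of the unit vectors over its support. *)
Lemma gen_subcubeE J x :
  (x \in gen_subcube [set delta_mx 0 i | i in J]) = (supp x \subset J).
Proof.
apply/idP/idP.
  have gJ : group_set [set y : cube m | supp y \subset J].
    apply/group_setP; split.
      by rewrite inE; apply/subsetP => i; rewrite inE mxE eqxx.
    move=> y z; rewrite !inE => /subsetP sy /subsetP sz.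
    apply/subsetP => i; rewrite inE mxE; apply: contraR => iJ.
    have -> : y 0 i = 0.
      by apply/eqP; apply: contraR iJ => yi; apply: sy; rewrite inE.
    have -> : z 0 i = 0.
      by apply/eqP; apply: contraR iJ => zi; apply: sz; rewrite inE.
    by rewrite addr0.
  suff /subsetP sJ : gen_subcube [set delta_mx 0 i | i in J] \subset Group gJ.
    by move/sJ; rewrite inE.
  rewrite gen_subG; apply/subsetP => _ /imsetP[i iJ ->]; rewrite inE.
  by apply/subsetP => j; rewrite inE !mxE eqxx; case: (eqVneq j i) => [-> |].
rewrite -{2}[x]suppK; move: (supp x) => T {x} /subsetP sTJ.
have -> : indic T = (\prod_(i in T) (delta_mx 0 i : cube m))%g.
  (* The group law on [cube m] is addition, so both sides are convertible. *)
  rewrite (_ : (\prod_(i in T) _)%g = \sum_(i in T) delta_mx 0 i) //.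
  apply/rowP => j; rewrite mxE summxE; under eq_bigr do rewrite mxE eqxx /=.
  have [jT|jT] := boolP (j \in T).
    rewrite (bigD1 j) //= eqxx big1 ?addr0 // => i /andP[_ ij].
    by rewrite eq_sym (negbTE ij).
  by rewrite big1 // => i iT; case: eqP jT => // ->; rewrite iT.
apply: group_prod => i /sTJ iJ.
by apply: mem_gen; apply: imset_f.
Qed.

End Subcubes.

(** * Diagonal gates, phases and code states *)

Section States.
Variables (R : realType) (m : nat).
Implicit Types (U : cube m -> 'M[R[i]]_2) (b : labels m) (psi : state R m).
Local Open Scope ring_scope.
Local Open Scope sesquilinear_scope.
Local Open Scope complex_scope.

Lemma tensor_op_diag U psi b : (forall x, is_diag_mx (U x)) ->
  tensor_op U psi b = (\prod_x U x (b x) (b x)) * psi b.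
Proof.
move=> dU; rewrite ffunE (bigD1 b) //= [X in _ + X]big1 ?addr0 // => c ncb.
(* A label c other than b differs from it at some qubit, where an off-diagonal zero kills the
   product. *)
have [x nx] : exists x, b x != c x.
  apply/existsP; apply: contraNT ncb; rewrite negb_exists => /forallP e.
  by apply/eqP/ffunP => x; apply/esym/eqP; move: (e x); rewrite negbK.
have /is_diag_mxP/(_ _ _ nx) e := dU x.
by rewrite (bigD1 x) //= e !mul0r.
Qed.

Lemma expiD (s t : R) : expi (s + t) = expi s * expi t.
Proof.
rewrite /expi cosD sinD; simpc; congr (_ +i* _).
by rewrite addrC mulrC [X in _ + X]mulrC.
Qed.

Lemma expiMn (t : R) n : expi (t *+ n) = expi t ^+ n.
Proof.
elim: n => [|n IH]; first by rewrite mulr0n /expi cos0 sin0 expr0.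
by rewrite mulrS expiD IH exprS.
Qed.

Lemma expi_conj (t : R) : ((expi t)^*)%C * expi t = 1.
Proof.
rewrite /expi; simpc.
by rewrite -!expr2 cos2Dsin2 [sin t * cos t]mulrC subrr.
Qed.

Lemma expi_sqr_root k : (expi (pi / 2 ^+ k : R) ^+ 2) ^+ (2 ^ k) = 1.
Proof.
rewrite -exprM mulnC exprM -expiMn -[_ *+ _]mulr_natr natrX.
rewrite divfK ?expf_neq0 ?pnatr_eq0 //.
by rewrite /expi cospi sinpi expr2; simpc.
Qed.

(* A label occurring in a code state is a codeword of the Reed-Muller code
   RM(r, m), the dual of the code spanned by the (r+1)-dimensional subcubes. *)
Lemma QRM_even_on_subcubes q r psi b : QRM q r psi -> psi b != 0 ->
  even_on_subcubes r.+1 (fun T => b (indic T) != 0).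
Proof.
move=> [_ codeZ] pb B J cJ dBJ.
pose A : {set cube m} :=
  [set indic B + y | y in gen_subcube [set delta_mx 0 i | i in J]].
have sA : is_subcube r.+1 A.
  exists (indic B), [set delta_mx 0 i | i in J]; split => //.
    by apply/subsetP => _ /imsetP[i _ ->]; apply: imset_f.
  by rewrite (card_imset _ (@delta_row_inj m)).
(* Comparing amplitudes at b and cancelling [psi b] shows that the sign (-1)^n is 1, where n counts
   the points of A at which b is 1. *)
have := congr1 (fun f : state R m => f b) (codeZ A sA).
rewrite /gate_on tensor_op_diag; last first.
  by move=> x; case: ifP => _; rewrite ?diag_mx_is_diag ?scalar_mx_is_diag.
rewrite -[RHS]mul1r => /(mulIf pb).
rewrite (eq_bigr (fun x => if x \in A then (-1) ^+ (b x != 0) else 1));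
    last first.
  move=> x _; case: ifP => _; last by rewrite mxE eqxx.
  by rewrite /pauliZ !mxE eqxx mulr1n; case: eqVneq.
rewrite -big_mkcond /= prodrXr.
have -> : (\sum_(x in A) (b x != 0%R) =
           \sum_(T : {set 'I_m} | T \subset J) (b (indic (B :|: T)) != 0%R))%N.
  rewrite /A big_imset /=; last by move=> ? ? _ _; apply: addrI.
  rewrite (reindex (@indic m)) /=; last first.
    by exists (@supp m) => ? _; [apply: indicK | apply: suppK].
  apply: eq_big => T; rewrite gen_subcubeE indicK // => sTJ.
  by rewrite indicU // disjoint_sym (disjointWl sTJ) // disjoint_sym.
rewrite -signr_odd; case: (odd _) => // /eqP.
by rewrite expr1 -subr_eq0 -opprD oppr_eq0 -mulr2n pnatr_eq0.
Qed.

Lemma Zrot_signed_equiv q r k (K : {set cube m}) : (0 < r)%N ->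
    K \subset std_basis m -> (k * r + 2 <= #|K|)%N ->
  logically_equiv (@QRM R m q r)
    (@Zrot_on R m k (gen_subcube K)) (@signed_Zrot_on R m k (gen_subcube K)).
Proof.
move=> r0 /std_basis_sub[J -> <-] leJ; exists 0 => psi code; apply/ffunP => b.
rewrite [RHS]ffunE (_ : expi 0 = 1) ?mul1r; last by rewrite /expi cos0 sin0.
rewrite /Zrot_on /signed_Zrot_on /gate_on !tensor_op_diag; first last.
- move=> x; case: ifP => _; last exact: scalar_mx_is_diag.
  by case: ifP => _; rewrite /Zrot ?tr_diag_mx ?map_diag_mx diag_mx_is_diag.
- by move=> x; case: ifP => _; rewrite ?diag_mx_is_diag ?scalar_mx_is_diag.
have [->|pb] := eqVneq (psi b) 0; first by rewrite !mulr0.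
congr (_ * _).
set A := gen_subcube _; pose w : R[i] := expi (pi / 2 ^+ k) ^+ 2.
(* At an odd point of A with b x = 1 the entry of Z(k) is w times that of its adjoint, because
   conj(z) z^2 = z for a phase z; elsewhere the two gates have equal entries. *)
rewrite (eq_bigr (fun x => (if x \in A then
    if odd (hweight x) then (Zrot R k)^t* else Zrot R k else 1%:M) (b x) (b x)
    * (if (x \in A) && odd (hweight x) then w ^+ (b x != 0) else 1))).
  rewrite big_split /= -[RHS]mulr1; congr (_ * _).
  rewrite -big_mkcond /= prodrXr.
  (* The total exponent of w is the number of odd points of A where b is 1, and w is a 2^k-th root
     of unity. *)
  have := dvdn_odd_support r0 leJ (QRM_even_on_subcubes code pb).
  rewrite (reindex (@supp m)) /=; last first.
    by exists (@indic m) => ? _; [apply: suppK | apply: indicK].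
  under eq_bigl => x do rewrite -gen_subcubeE -/(hweight x).
  under eq_bigr => x _ do rewrite suppK.
  by case/dvdnP => N ->; rewrite mulnC exprM expi_sqr_root expr1n.
move=> x _; case: ifP => xA /=; last by rewrite mulr1.
case: ifP => ox; last by rewrite mulr1.
rewrite /Zrot !mxE eqxx !mulr1n; case: eqVneq => _ /=.
  by rewrite expr0 mulr1 rmorph1.
by rewrite expr1 /w expr2 mulrA expi_conj mul1r.
Qed.

End States.

Theorem theorem8p2 (R : realType) (m q r k : nat) (hqr : (q < r)%N)
  (hrm : (r <= m)%N) (K : {set cube m}) (hK : K \in Qset m q r k) :
  ((1 <= q)%N ->
     logically_equiv (@QRM R m q r)
       (@Zrot_on R m k (gen_subcube K))
       (@signed_Zrot_on R m k (gen_subcube K))) /\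
  ((q + k * r + 2 <= #|K|)%N ->
     logically_equiv (@QRM R m q r)
       (@Zrot_on R m k (gen_subcube K))
       (@signed_Zrot_on R m k (gen_subcube K))).
Proof.
move: hK; rewrite inE => /andP[sK /andP[leK _]].
have r0 : (0 < r)%N by apply: leq_ltn_trans hqr.
(* Either assumption yields k r + 2 <= |K|: the first through q >= 1 and the lower bound q + k r + 1
   from [Qset], the second directly. *)
by split=> leq; apply: Zrot_signed_equiv => //; lia.
Qed.
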